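(* Let $(H,R,\alpha)$ be a quasitriangular Hom-Hopf algebra and $(B,\langle|\rangle,\beta)$ a coquasitriangular Hom-Hopf algebra. For left-left $(H,B)$-Hom-Long dimodules $(M,\mu),(N,\nu)$ put $$C_{M,N}:M\otimes N\to N\otimes M,\qquad m\otimes n\mapsto\langle m_{(-1)}|n_{(-1)}\rangle\, R^{(2)}\cdot\nu^{-2}(n_{(0)})\otimes R^{(1)}\cdot\mu^{-2}(m_{(0)}).$$ Then $C$ is a solution of the quantum Yang–Baxter equation: for all $(U,\mu),(V,\nu),(W,\omega)\in{}^{B}_{H}\mathbb{L}$, $$(id_W\otimes C_{U,V})\circ a_{W,U,V}\circ(C_{U,W}\otimes id_V)\circ a^{-1}_{U,W,V}\circ(id_U\otimes C_{V,W})\circ a_{U,V,W}$$ $$=a_{W,V,U}\circ(C_{V,W}\otimes id_U)\circ a^{-1}_{V,W,U}\circ(id_V\otimes C_{U,W})\circ a_{V,U,W}\circ(C_{U,V}\otimes id_W)$$ as maps $(U\otimes V)\otimes W\to W\otimes(V\otimes U)$.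
   Context: All vector spaces, maps and tensor products are over a fixed field $k$; Sweedler notation $\Delta(c)=c_1\otimes c_2$ is used, and $\rho(m)=m_{(-1)}\otimes m_{(0)}$ for coactions. A Hom-algebra $(A,\mu_A,1_A,\alpha)$: a linear space $A$ with a linear multiplication, $1_A\in A$ and a linear bijection $\alpha:A\to A$ with $\alpha(aa')=\alpha(a)\alpha(a')$, $\alpha(1_A)=1_A$, $\alpha(a)(a'a'')=(aa')\alpha(a'')$, $a1_A=1_Aa=\alpha(a)$. A left $(A,\alpha)$-Hom-module $(M,\cdot,\mu)$: a linear space $M$, linear $\cdot:A\otimes M\to M$, and a linear bijection $\mu:M\to M$ with $\mu(a\cdot m)=\alpha(a)\cdot\mu(m)$, $\alpha(a)\cdot(a'\cdot m)=(aa')\cdot\mu(m)$, $1_A\cdot m=\mu(m)$. A Hom-coalgebra $(C,\Delta,\epsilon,\beta)$: linear $\Delta:C\to C\otimes C$, $\epsilon:C\to k$, and a linear bijection $\beta$ with $\Delta(\beta(c))=\beta(c_1)\otimes\beta(c_2)$, $\epsilon\circ\beta=\epsilon$, $\beta(c_1)\otimes c_{21}\otimes c_{22}=c_{11}\otimes c_{12}\otimes\beta(c_2)$, $\epsilon(c_1)c_2=c_1\epsilon(c_2)=\beta(c)$. A left $(C,\beta)$-Hom-comodule $(M,\rho,\mu)$: linear $\rho:M\to C\otimes M$ and a linear bijection $\mu$ with $\rho(\mu(m))=\beta(m_{(-1)})\otimes\mu(m_{(0)})$, $\epsilon(m_{(-1)})m_{(0)}=\mu(m)$, $\beta(m_{(-1)})\otimes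 m_{(0)(-1)}\otimes m_{(0)(0)}=m_{(-1)1}\otimes m_{(-1)2}\otimes\mu(m_{(0)})$. A Hom-bialgebra $(H,\alpha)$: a Hom-algebra and Hom-coalgebra with the same structure map $\alpha$ such that $\Delta(hh')=\Delta(h)\Delta(h')$, $\Delta(1)=1\otimes1$, $\epsilon(hh')=\epsilon(h)\epsilon(h')$, $\epsilon(1)=1$. It is a Hom-Hopf algebra if there is a linear map $S:H\to H$ (antipode) with $S(h_1)h_2=h_1S(h_2)=\epsilon(h)1_H$ and $S\circ\alpha=\alpha\circ S$. A quasitriangular Hom-Hopf algebra $(H,R,\alpha)$: a Hom-Hopf algebra $(H,\alpha)$ with $R=R^{(1)}\otimes R^{(2)}\in H\otimes H$ (summation understood, $r=r^{(1)}\otimes r^{(2)}$ a second copy of $R$) such that $\epsilon(R^{(1)})R^{(2)}=R^{(1)}\epsilon(R^{(2)})=1_H$; $\Delta(R^{(1)})\otimes\alpha(R^{(2)})=\alpha(R^{(1)})\otimes\alpha(r^{(1)})\otimes R^{(2)}r^{(2)}$; $\alpha(R^{(1)})\otimes\Delta(R^{(2)})=R^{(1)}r^{(1)}\otimes\alpha(r^{(2)})\otimes\alpha(R^{(2)})$; $\Delta^{cop}(h)R=R\Delta(h)$ with $\Delta^{cop}(h)=h_2\otimes h_1$; $\alpha(R^{(1)})\otimes\alpha(R^{(2)})=R^{(1)}\otimes R^{(2)}$. A coquasitriangular Hom-Hopf algebra $(B,\langle|\rangle,\beta)$: a Hom-Hopf algebra $(B,\beta)$ with a bilinear form $\langle|\rangle:B\otimes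 B\to k$ such that for all $h,g,l\in B$: $\langle hg|\beta(l)\rangle=\langle\beta(h)|l_2\rangle\langle\beta(g)|l_1\rangle$; $\langle\beta(h)|gl\rangle=\langle h_1|\beta(g)\rangle\langle h_2|\beta(l)\rangle$; $\langle h_1|g_1\rangle g_2h_2=h_1g_1\langle h_2|g_2\rangle$; $\langle1|h\rangle=\langle h|1\rangle=\epsilon(h)$; $\langle\beta(h)|\beta(g)\rangle=\langle h|g\rangle$. A left-left $(H,B)$-Hom-Long dimodule $(M,\cdot,\rho,\mu)$: $(M,\cdot,\mu)$ is a left $(H,\alpha)$-Hom-module and $(M,\rho,\mu)$ is a left $(B,\beta)$-Hom-comodule with $\rho(h\cdot m)=\beta(m_{(-1)})\otimes\alpha(h)\cdot m_{(0)}$. The category ${}^{B}_{H}\mathbb{L}$ has these as objects and, as morphisms, the $H$-linear $B$-colinear maps commuting with structure maps. The tensor product of $(M,\mu),(N,\nu)\in{}^{B}_{H}\mathbb{L}$ is $(M\otimes N,\mu\otimes\nu)$ with $h\cdot(m\otimes n)=h_1\cdot m\otimes h_2\cdot n$ and $\rho(m\otimes n)=\beta^{-2}(m_{(-1)}n_{(-1)})\otimes m_{(0)}\otimes n_{(0)}$; for $(U,\mu),(V,\nu),(W,\omega)$ the associator is $a_{U,V,W}:(U\otimes V)\otimes W\to U\otimes(V\otimes W)$, $a_{U,V,W}((u\otimes v)\otimes w)=\mu^{-1}(u)\otimes(v\otimes\omega(w))$. *)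

(* Defs.v *)
From HB Require Import structures.
From mathcomp Require Import all_boot all_algebra.
From mathcomp Require Import boolp.

Set Implicit Arguments.
Unset Strict Implicit.
Unset Printing Implicit Defensive.

Import GRing.Theory.
Local Open Scope ring_scope.
Local Open Scope quotient_scope.

Reserved Notation "u ⊗ v" (at level 40, left associativity).
Reserved Notation "U ⊗[ k ] V" (at level 40, left associativity,
  format "U  ⊗[ k ]  V").
Reserved Notation "\tsum_ ( x ⊗ y <- t ) F"
  (at level 41, F at level 41, t at level 200, x name, y name,
   format "'[' \tsum_ ( x  ⊗  y  <-  t ) '/  '  F ']'").

(* An element of [tensor U V] is a class of formal sums [:: (u1, v1); ...]
   standing for u1 ⊗ v1 + ...; scalars are absorbed in the first factor, so the
   relations of the tensor product are the ones below (there is no subtraction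
   of formal sums, hence the separate rule for 0 ⊗ v). *)
Inductive tensor_eq (k : fieldType) (U V : lmodType k) :
    seq (U * V) -> seq (U * V) -> Prop :=
| tensor_eq_refl s : tensor_eq s s
| tensor_eq_sym s t : tensor_eq s t -> tensor_eq t s
| tensor_eq_trans s t r : tensor_eq s t -> tensor_eq t r -> tensor_eq s r
| tensor_eq_cat s s' t t' :
    tensor_eq s s' -> tensor_eq t t' -> tensor_eq (s ++ t) (s' ++ t')
| tensor_eq_catC s t : tensor_eq (s ++ t) (t ++ s)
| tensor_eq_Dl u u' v : tensor_eq [:: (u + u', v)] [:: (u, v); (u', v)]
| tensor_eq_Dr u v v' : tensor_eq [:: (u, v + v')] [:: (u, v); (u, v')]
| tensor_eq_Z a u v : tensor_eq [:: (a *: u, v)] [:: (u, a *: v)]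
| tensor_eq_0 v : tensor_eq [:: (0, v)] [::].

Section Tensor.
Variables (k : fieldType) (U V : lmodType k).
Implicit Types (s t : seq (U * V)) (a b : k).

Definition tensor_rel s t : bool := `[< tensor_eq s t >].

Lemma tensor_rel_equiv : equiv_class_of tensor_rel.
Proof.
split=> [s|s t|t s r].
- exact/asboolP/tensor_eq_refl.
- by apply/asboolP/asboolP => /tensor_eq_sym.
- by move=> /asboolP st /asboolP tr; apply/asboolP/(tensor_eq_trans st tr).
Qed.

Canonical tensor_equiv := EquivRelPack tensor_rel_equiv.

Definition tensor := {eq_quot tensor_rel}.
HB.instance Definition _ := Choice.on tensor.
HB.instance Definition _ := EqQuotient.on tensor.

Implicit Types x y z : tensor.

Lemma tensor_piP s t : tensor_eq s t <-> \pi_tensor s = \pi_tensor t.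
Proof. by split=> [?|/eqmodP /asboolP //]; apply/eqmodP/asboolP. Qed.

Lemma tensor_reprP s : tensor_eq (repr (\pi_tensor s)) s.
Proof. by apply/tensor_piP; rewrite reprK. Qed.

Definition tensor0 : tensor := \pi_tensor [::].
Definition tensor_add x y : tensor := \pi_tensor (repr x ++ repr y).
Definition tensor_scale_seq a s := [seq (a *: p.1, p.2) | p <- s].
Definition tensor_scale a x : tensor := \pi_tensor (tensor_scale_seq a (repr x)).
Definition tensor_opp x := tensor_scale (- 1) x.

Lemma tensor_scale_seq_eq a s t :
  tensor_eq s t -> tensor_eq (tensor_scale_seq a s) (tensor_scale_seq a t).
Proof.
elim=> [{}s|{}s {}t _|{}s {}t r _ st _|s1 s2 t1 t2 _ IHs _ IHt|{}s {}t
       |u u' v|u v v'|b u v|v] /=.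
- exact: tensor_eq_refl.
- exact: tensor_eq_sym.
- exact: tensor_eq_trans.
- by rewrite /tensor_scale_seq !map_cat; apply: tensor_eq_cat.
- by rewrite /tensor_scale_seq !map_cat; apply: tensor_eq_catC.
- by rewrite scalerDr; apply: tensor_eq_Dl.
- exact: tensor_eq_Dr.
- by rewrite scalerA mulrC -scalerA; apply: tensor_eq_Z.
- by rewrite scaler0; apply: tensor_eq_0.
Qed.

Lemma tensor_add_pi s t :
  tensor_add (\pi_tensor s) (\pi_tensor t) = \pi_tensor (s ++ t).
Proof. by apply/tensor_piP/tensor_eq_cat; apply: tensor_reprP. Qed.

Lemma tensor_scale_pi a s :
  tensor_scale a (\pi_tensor s) = \pi_tensor (tensor_scale_seq a s).
Proof. exact/tensor_piP/tensor_scale_seq_eq/tensor_reprP. Qed.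

Lemma tensor_addA : associative tensor_add.
Proof.
move=> x y z; rewrite -[x]reprK -[y]reprK -[z]reprK.
move: (repr x) (repr y) (repr z) => r s t.
rewrite (tensor_add_pi s t) (tensor_add_pi r s) (tensor_add_pi r (s ++ t)).
by rewrite (tensor_add_pi (r ++ s) t) catA.
Qed.

Lemma tensor_addC : commutative tensor_add.
Proof. by move=> x y; apply/tensor_piP/tensor_eq_catC. Qed.

Lemma tensor_add0 : left_id tensor0 tensor_add.
Proof. by move=> x; rewrite -[x]reprK tensor_add_pi. Qed.

Lemma tensor_scaleDl x a b :
  tensor_scale (a + b) x = tensor_add (tensor_scale a x) (tensor_scale b x).
Proof.
rewrite -[x]reprK; move: (repr x) => r; rewrite !(tensor_scale_pi _ r).
rewrite (tensor_add_pi (tensor_scale_seq a r)); apply/tensor_piP.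
elim: r => [|[u v] s IH] /=; first exact: tensor_eq_refl.
rewrite scalerDl -cat1s; apply: tensor_eq_trans.
  exact: tensor_eq_cat (tensor_eq_Dl _ _ _) IH.
set P := tensor_scale_seq a s; set Q := tensor_scale_seq b s.
suff: tensor_eq ([:: (a *: u, v)] ++ (([:: (b *: u, v)] ++ P) ++ Q))
                ([:: (a *: u, v)] ++ ((P ++ [:: (b *: u, v)]) ++ Q)).
  by rewrite -!catA.
apply: tensor_eq_cat (tensor_eq_refl _) (tensor_eq_cat _ (tensor_eq_refl _)).
exact: tensor_eq_catC.
Qed.

Lemma tensor_scale0 x : tensor_scale 0 x = tensor0.
Proof.
apply/tensor_piP; elim: (repr x) => [|[u v] s IH] /=; first exact: tensor_eq_refl.
by rewrite scale0r; exact: (tensor_eq_cat (tensor_eq_0 U v) IH).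
Qed.

Lemma tensor_scaleA a b x :
  tensor_scale a (tensor_scale b x) = tensor_scale (a * b) x.
Proof.
rewrite -[x]reprK; move: (repr x) => r.
rewrite !(tensor_scale_pi _ r) (tensor_scale_pi _ (tensor_scale_seq b r)).
rewrite /tensor_scale_seq -map_comp.
by congr (\pi_tensor _); apply: eq_map => p /=; rewrite scalerA.
Qed.

Lemma tensor_scale1 : left_id 1 tensor_scale.
Proof.
move=> x; rewrite -[x]reprK tensor_scale_pi /tensor_scale_seq.
by congr (\pi_tensor _); rewrite -[RHS]map_id; apply: eq_map => -[u v]; rewrite scale1r.
Qed.

Lemma tensor_addN : left_inverse tensor0 tensor_opp tensor_add.
Proof.
by move=> x; rewrite -{2}[x]tensor_scale1 -tensor_scaleDl addNr tensor_scale0.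
Qed.

HB.instance Definition _ := GRing.isZmodule.Build tensor
  tensor_addA tensor_addC tensor_add0 tensor_addN.

Lemma tensor_scaleDr : right_distributive tensor_scale +%R.
Proof.
move=> a x y; rewrite -[x]reprK -[y]reprK; move: (repr x) (repr y) => r s.
rewrite [in LHS]/GRing.add /= (tensor_add_pi r s) !tensor_scale_pi.
rewrite /GRing.add /= (tensor_add_pi (tensor_scale_seq a r)).
by rewrite /tensor_scale_seq map_cat.
Qed.

HB.instance Definition _ := GRing.Zmodule_isLmodule.Build k tensor
  tensor_scaleA tensor_scale1 tensor_scaleDr tensor_scaleDl.

Lemma tensor_piD s t : \pi_tensor (s ++ t) = \pi_tensor s + \pi_tensor t.
Proof. by rewrite -tensor_add_pi. Qed.

Lemma tensor_piZ a s : \pi_tensor (tensor_scale_seq a s) = a *: \pi_tensor s.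
Proof. by rewrite -tensor_scale_pi. Qed.

Definition pure (u : U) (v : V) : tensor := \pi_tensor [:: (u, v)].

Lemma tensor_reprE x : x = \sum_(p <- repr x) pure p.1 p.2.
Proof.
rewrite -[LHS]reprK; elim: (repr x) => [|[u v] s IH]; first by rewrite big_nil.
by rewrite big_cons -IH -tensor_piD.
Qed.

Lemma pure_bilinear : bilinear_for *:%R *:%R pure.
Proof.
split=> [v|u] a x y; rewrite /= -tensor_piZ -tensor_piD.
  exact/tensor_piP/tensor_eq_Dl.
apply/tensor_piP; apply: tensor_eq_trans (tensor_eq_Dr _ _ _) _.
rewrite -cat1s -[X in tensor_eq _ X]cat1s; apply: tensor_eq_cat (tensor_eq_refl _).
exact/tensor_eq_sym/tensor_eq_Z.
Qed.

HB.instance Definition _ :=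
  bilinear_isBilinear.Build k U V tensor *:%R *:%R pure pure_bilinear.

(* Sum of [f] over a representation of [x] as a sum of pure tensors: this is
   Sweedler's notation.  It does not depend on the representation when [f] is
   bilinear ([tlift_pure], [tlift_linear], [tensor_reprE]), and is then the
   linear map on the tensor product induced by [f]. *)
Definition tlift (W : nmodType) (f : U -> V -> W) (x : tensor) : W :=
  \sum_(p <- repr x) f p.1 p.2.

Section Lift.
Variables (W : lmodType k) (f : U -> V -> W).
Hypothesis f_bilin : bilinear_for *:%R *:%R f.

Lemma tensor_eq_sum s t : tensor_eq s t ->
  \sum_(p <- s) f p.1 p.2 = \sum_(p <- t) f p.1 p.2.
Proof.
have f0 v : f 0 v = 0.
  by have := f_bilin.1 v (-1) 0 0; rewrite /= scaler0 addr0 scaleN1r addNr.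
have f0r u : f u 0 = 0.
  by have := f_bilin.2 u (-1) 0 0; rewrite /= scaler0 addr0 scaleN1r addNr.
elim=> [//|//|{}s {}t r _ -> _ //|s1 s2 t1 t2 _ IHs _ IHt|{}s {}t
       |u u' v|u v v'|b u v|v]; rewrite ?big_cat ?big_cons ?big_nil /= ?addr0.
- by rewrite IHs IHt.
- by rewrite addrC.
- by have := f_bilin.1 v 1 u u'; rewrite /= !scale1r.
- by have := f_bilin.2 u 1 v v'; rewrite /= !scale1r.
- have /= := f_bilin.1 v b u 0; rewrite f0 !addr0 => ->.
  by have /= := f_bilin.2 u b v 0; rewrite f0r !addr0 => ->.
- exact: f0.
Qed.

Lemma tlift_pure u v : tlift f (pure u v) = f u v.
Proof. by rewrite /tlift (tensor_eq_sum (tensor_reprP _)) big_seq1. Qed.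

Lemma tlift_linear : linear (tlift f).
Proof.
move=> a x y; rewrite -[x]reprK -[y]reprK -tensor_piZ -tensor_piD.
rewrite /tlift !(tensor_eq_sum (tensor_reprP _)).
rewrite big_cat big_map scaler_sumr; congr (_ + _); apply: eq_bigr => p _.
have f0 v : f 0 v = 0.
  by have := f_bilin.1 v (-1) 0 0; rewrite /= scaler0 addr0 scaleN1r addNr.
by have /= := f_bilin.1 p.2 a p.1 0; rewrite f0 !addr0.
Qed.

End Lift.
End Tensor.

Notation "U ⊗[ k ] V" := (@tensor k U V) : type_scope.
Notation "U ⊗[ k ] V" := (@tensor k U V) (only parsing) : ring_scope.
Notation "u ⊗ v" := (pure u v) : ring_scope.
Notation "\tsum_ ( x ⊗ y <- t ) F" := (tlift (fun x y => F) t) : ring_scope.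

Section TensorMaps.
Variable k : fieldType.

Lemma tensor_ext (U V W : lmodType k) (f g : {linear U ⊗[k] V -> W}) :
  (forall u v, f (u ⊗ v) = g (u ⊗ v)) -> f =1 g.
Proof.
by move=> fg x; rewrite (tensor_reprE x) !linear_sum; apply: eq_bigr => p _.
Qed.

Lemma tensor_extl (U V W X : lmodType k) (f g : {linear U ⊗[k] V ⊗[k] W -> X}) :
  (forall u v w, f (u ⊗ v ⊗ w) = g (u ⊗ v ⊗ w)) -> f =1 g.
Proof.
move=> fg; apply: tensor_ext => x w; rewrite (tensor_reprE x) linear_sumlz.
by rewrite !linear_sum; apply: eq_bigr => p _; apply: fg.
Qed.

Lemma tensor_extr (U V W X : lmodType k)
    (f g : {linear U ⊗[k] (V ⊗[k] W) -> X}) :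
  (forall u v w, f (u ⊗ (v ⊗ w)) = g (u ⊗ (v ⊗ w))) -> f =1 g.
Proof.
move=> fg; apply: tensor_ext => u x; rewrite (tensor_reprE x) linear_sumr.
by rewrite !linear_sum; apply: eq_bigr => p _; apply: fg.
Qed.

Lemma sum_is_linear (U W : lmodType k) (I : Type) (r : seq I) (f : I -> U -> W) :
  (forall i, linear (f i)) -> linear (fun u => \sum_(i <- r) f i u).
Proof.
move=> fL a u v; rewrite scaler_sumr -big_split /=.
by apply: eq_bigr => i _; apply: fL.
Qed.

Definition tmap (U V U' V' : lmodType k) (f : U -> U') (g : V -> V') :
  U ⊗[k] V -> U' ⊗[k] V' := tlift (fun u v => f u ⊗ g v).

Section TMap.
Variables (U V U' V' : lmodType k) (f : {linear U -> U'}) (g : {linear V -> V'}).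

Lemma tmap_bilinear : bilinear_for *:%R *:%R (fun u v => f u ⊗ g v).
Proof. by split=> [v|u] a x y /=; rewrite linearP ?linearPl ?linearPr. Qed.

Lemma tmap_linear : linear (tmap f g).
Proof. exact: tlift_linear tmap_bilinear. Qed.

HB.instance Definition _ := GRing.isLinear.Build k _ _ _ (tmap f g) tmap_linear.

Lemma tmap_pure u v : tmap f g (u ⊗ v) = f u ⊗ g v.
Proof. exact: tlift_pure tmap_bilinear _ _. Qed.

End TMap.
End TensorMaps.

Record linAut (k : fieldType) (V : lmodType k) := LinAut {
  lin_fun :> {linear V -> V};
  lin_inv : {linear V -> V};
  lin_funK : cancel lin_fun lin_inv;
  lin_invK : cancel lin_inv lin_fun
}.

Record homAlgebra (k : fieldType) (A : lmodType k)
    (mul : {bilinear A -> A -> A}) (one : A) (alpha : linAut A) : Prop := {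
  alpha_mul : forall a b, alpha (mul a b) = mul (alpha a) (alpha b);
  alpha_one : alpha one = one;
  mul_homA : forall a b c, mul (alpha a) (mul b c) = mul (mul a b) (alpha c);
  mul_one : forall a, mul a one = alpha a;
  one_mul : forall a, mul one a = alpha a
}.

Record homCoalgebra (k : fieldType) (C : lmodType k)
    (Delta : {linear C -> C ⊗[k] C}) (eps : {scalar C}) (beta : linAut C) :
    Prop := {
  beta_comul : forall c,
    Delta (beta c) = \tsum_(c1 ⊗ c2 <- Delta c) (beta c1 ⊗ beta c2);
  beta_counit : forall c, eps (beta c) = eps c;
  comul_homA : forall c,
    \tsum_(c1 ⊗ c2 <- Delta c) \tsum_(c21 ⊗ c22 <- Delta c2)
      (beta c1 ⊗ (c21 ⊗ c22)) =
    \tsum_(c1 ⊗ c2 <- Delta c) \tsum_(c11 ⊗ c12 <- Delta c1)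
      (c11 ⊗ (c12 ⊗ beta c2));
  counit_comul : forall c, \tsum_(c1 ⊗ c2 <- Delta c) (eps c1 *: c2) = beta c;
  comul_counit : forall c, \tsum_(c1 ⊗ c2 <- Delta c) (eps c2 *: c1) = beta c
}.

Record homBialgebra (k : fieldType) (H : lmodType k)
    (mul : {bilinear H -> H -> H}) (one : H)
    (Delta : {linear H -> H ⊗[k] H}) (eps : {scalar H}) (alpha : linAut H) :
    Prop := {
  bialg_alg : homAlgebra mul one alpha;
  bialg_coalg : homCoalgebra Delta eps alpha;
  comul_mul : forall h g,
    Delta (mul h g) =
    \tsum_(h1 ⊗ h2 <- Delta h) \tsum_(g1 ⊗ g2 <- Delta g)
      (mul h1 g1 ⊗ mul h2 g2);
  comul_one : Delta one = one ⊗ one;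
  counit_mul : forall h g, eps (mul h g) = eps h * eps g;
  counit_one : eps one = 1
}.

Record homHopfAlgebra (k : fieldType) := HomHopfAlgebra {
  hopf_space :> lmodType k;
  hmul : {bilinear hopf_space -> hopf_space -> hopf_space};
  hone : hopf_space;
  Delta : {linear hopf_space -> hopf_space ⊗[k] hopf_space};
  eps : {scalar hopf_space};
  alpha : linAut hopf_space;
  hopf_bialg : homBialgebra hmul hone Delta eps alpha;
  hopf_antipode : exists S : {linear hopf_space -> hopf_space},
    forall h,
      [/\ \tsum_(h1 ⊗ h2 <- Delta h) hmul (S h1) h2 = eps h *: hone,
          \tsum_(h1 ⊗ h2 <- Delta h) hmul h1 (S h2) = eps h *: hone
        & S (alpha h) = alpha (S h)]
}.

Arguments hmul {k h}.
Arguments hone {k}.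
Arguments Delta {k h}.
Arguments eps {k h}.
Arguments alpha {k h}.

Record quasitriangular (k : fieldType) := Quasitriangular {
  qt_hopf :> homHopfAlgebra k;
  Rmx : qt_hopf ⊗[k] qt_hopf;
  eps_Rmx : \tsum_(x ⊗ y <- Rmx) (eps x *: y) = hone qt_hopf;
  Rmx_eps : \tsum_(x ⊗ y <- Rmx) (eps y *: x) = hone qt_hopf;
  Delta_Rmx :
    \tsum_(x ⊗ y <- Rmx) (Delta x ⊗ alpha y) =
    \tsum_(x ⊗ y <- Rmx) \tsum_(x' ⊗ y' <- Rmx)
      (alpha x ⊗ alpha x' ⊗ hmul y y');
  Rmx_Delta :
    \tsum_(x ⊗ y <- Rmx) (alpha x ⊗ Delta y) =
    \tsum_(x ⊗ y <- Rmx) \tsum_(x' ⊗ y' <- Rmx)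
      (hmul x x' ⊗ (alpha y' ⊗ alpha y));
  Rmx_comm : forall h : qt_hopf,
    \tsum_(h1 ⊗ h2 <- Delta h) \tsum_(x ⊗ y <- Rmx) (hmul h2 x ⊗ hmul h1 y) =
    \tsum_(x ⊗ y <- Rmx) \tsum_(h1 ⊗ h2 <- Delta h) (hmul x h1 ⊗ hmul y h2);
  Rmx_alpha :
    \tsum_(x ⊗ y <- Rmx) (alpha x ⊗ alpha y) = Rmx
}.

Record coquasitriangular (k : fieldType) := Coquasitriangular {
  cqt_hopf :> homHopfAlgebra k;
  cform : {biscalar cqt_hopf};
  cform_mull : forall h g l : cqt_hopf,
    cform (hmul h g) (alpha l) =
    \tsum_(l1 ⊗ l2 <- Delta l)
      (cform (alpha h) l2 * cform (alpha g) l1);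
  cform_mulr : forall h g l : cqt_hopf,
    cform (alpha h) (hmul g l) =
    \tsum_(h1 ⊗ h2 <- Delta h)
      (cform h1 (alpha g) * cform h2 (alpha l));
  cform_comm : forall h g : cqt_hopf,
    \tsum_(h1 ⊗ h2 <- Delta h) \tsum_(g1 ⊗ g2 <- Delta g)
      (cform h1 g1 *: hmul g2 h2) =
    \tsum_(h1 ⊗ h2 <- Delta h) \tsum_(g1 ⊗ g2 <- Delta g)
      (cform h2 g2 *: hmul h1 g1);
  cform1l : forall h : cqt_hopf, cform (hone cqt_hopf) h = eps h;
  cform1r : forall h : cqt_hopf, cform h (hone cqt_hopf) = eps h;
  cform_alpha : forall h g : cqt_hopf,
    cform (alpha h) (alpha g) = cform h g
}.

Arguments Rmx {k}.
Arguments cform {k c}.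

Record homModule (k : fieldType) (A : lmodType k)
    (mul : {bilinear A -> A -> A}) (one : A) (alpha : linAut A)
    (M : lmodType k) (act : {bilinear A -> M -> M}) (mu : linAut M) :
    Prop := {
  mu_act : forall a m, mu (act a m) = act (alpha a) (mu m);
  act_homA : forall a b m, act (alpha a) (act b m) = act (mul a b) (mu m);
  one_act : forall m, act one m = mu m
}.

Record homComodule (k : fieldType) (C : lmodType k)
    (Delta : {linear C -> C ⊗[k] C}) (eps : {scalar C}) (beta : linAut C)
    (M : lmodType k) (rho : {linear M -> C ⊗[k] M}) (mu : linAut M) : Prop := {
  mu_coact : forall m,
    rho (mu m) = \tsum_(c ⊗ m0 <- rho m) (beta c ⊗ mu m0);
  counit_coact : forall m, \tsum_(c ⊗ m0 <- rho m) (eps c *: m0) = mu m;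
  coact_homA : forall m,
    \tsum_(c ⊗ m0 <- rho m) \tsum_(c' ⊗ m00 <- rho m0)
      (beta c ⊗ (c' ⊗ m00)) =
    \tsum_(c ⊗ m0 <- rho m) \tsum_(c1 ⊗ c2 <- Delta c)
      (c1 ⊗ (c2 ⊗ mu m0))
}.

Record longDimodule (k : fieldType) (H B : homHopfAlgebra k) := LongDimodule {
  long_space :> lmodType k;
  act : {bilinear H -> long_space -> long_space};
  coact : {linear long_space -> B ⊗[k] long_space};
  mu : linAut long_space;
  long_module : homModule (@hmul k H) (hone H) (@alpha k H) act mu;
  long_comodule : homComodule (@Delta k B) (@eps k B) (@alpha k B) coact mu;
  long_compat : forall (h : H) (m : long_space),
    coact (act h m) =
    \tsum_(b ⊗ m0 <- coact m) (alpha b ⊗ act (alpha h) m0)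
}.

Arguments act {k H B l}.
Arguments coact {k H B l}.
Arguments mu {k H B} l.

Section Long.
Variable k : fieldType.

Section Associator.
Variables (H B : homHopfAlgebra k) (U V W : longDimodule H B).

Definition hassoc : (U ⊗[k] V) ⊗[k] W -> U ⊗[k] (V ⊗[k] W) :=
  tlift (fun x w => \tsum_(u ⊗ v <- x) (lin_inv (mu U) u ⊗ (v ⊗ mu W w))).

Definition hassocV : U ⊗[k] (V ⊗[k] W) -> (U ⊗[k] V) ⊗[k] W :=
  tlift (fun u y => \tsum_(v ⊗ w <- y) ((mu U u ⊗ v) ⊗ lin_inv (mu W) w)).

Let f w : bilinear_for *:%R *:%R
  (fun (u : U) (v : V) => lin_inv (mu U) u ⊗ (v ⊗ mu W w)).
Proof. by split=> [v|u] a x y /=; rewrite ?linearP ?linearPl ?linearPr. Qed.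

Let g u : bilinear_for *:%R *:%R
  (fun (v : V) (w : W) => (mu U u ⊗ v) ⊗ lin_inv (mu W) w).
Proof. by split=> [w|v] a x y /=; rewrite ?linearP ?linearPr ?linearPl. Qed.

Let hassoc_bilinear : bilinear_for *:%R *:%R
  (fun (x : U ⊗[k] V) (w : W) =>
     \tsum_(u ⊗ v <- x) (lin_inv (mu U) u ⊗ (v ⊗ mu W w))).
Proof.
split=> [w|x]; first exact: tlift_linear (f w).
apply: sum_is_linear => p a w w' /=.
by rewrite linearP !linearPr.
Qed.

Let hassocV_bilinear : bilinear_for *:%R *:%R
  (fun (u : U) (y : V ⊗[k] W) =>
     \tsum_(v ⊗ w <- y) ((mu U u ⊗ v) ⊗ lin_inv (mu W) w)).
Proof.
split=> [y|u]; last exact: tlift_linear (g u).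
apply: sum_is_linear => p a u u' /=.
by rewrite linearP !linearPl.
Qed.

Lemma hassoc_linear : linear hassoc.
Proof. exact: tlift_linear hassoc_bilinear. Qed.

Lemma hassocV_linear : linear hassocV.
Proof. exact: tlift_linear hassocV_bilinear. Qed.

HB.instance Definition _ := GRing.isLinear.Build k _ _ _ hassoc hassoc_linear.
HB.instance Definition _ := GRing.isLinear.Build k _ _ _ hassocV hassocV_linear.

Lemma hassocE u v w :
  hassoc ((u ⊗ v) ⊗ w) = lin_inv (mu U) u ⊗ (v ⊗ mu W w).
Proof. by rewrite /hassoc (tlift_pure hassoc_bilinear) (tlift_pure (f w)). Qed.

Lemma hassocVE u v w :
  hassocV (u ⊗ (v ⊗ w)) = (mu U u ⊗ v) ⊗ lin_inv (mu W) w.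
Proof. by rewrite /hassocV (tlift_pure hassocV_bilinear) (tlift_pure (g u)). Qed.

Lemma hassocK : cancel hassoc hassocV.
Proof.
apply: (tensor_extl (f := hassocV \o hassoc) (g := idfun)) => u v w /=.
by rewrite hassocE hassocVE lin_invK lin_funK.
Qed.

Lemma hassocVK : cancel hassocV hassoc.
Proof.
apply: (tensor_extr (f := hassoc \o hassocV) (g := idfun)) => u v w /=.
by rewrite hassocVE hassocE lin_invK lin_funK.
Qed.

End Associator.

Section Braiding.
Variables (H : quasitriangular k) (B : coquasitriangular k).
Variables M N : longDimodule H B.

Definition braid_pure (m : M) (n : N) : N ⊗[k] M :=
  \tsum_(b ⊗ m0 <- coact m) \tsum_(c ⊗ n0 <- coact n) \tsum_(x ⊗ y <- Rmx H)
    (cform b c *: (act y (lin_inv (mu N) (lin_inv (mu N) n0)) ⊗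
                   act x (lin_inv (mu M) (lin_inv (mu M) m0)))).

Definition braid : M ⊗[k] N -> N ⊗[k] M := tlift braid_pure.

Lemma braid_bilinear : bilinear_for *:%R *:%R braid_pure.
Proof.
split=> [n|m] a.
  move=> m m'; rewrite /braid_pure linearP; apply: tlift_linear.
  split=> [m0|b].
    apply: sum_is_linear => p; apply: sum_is_linear => q {}a b b' /=.
    by rewrite linearPl scalerDl scalerA.
  apply: sum_is_linear => p; apply: sum_is_linear => q {}a u u' /=.
  by rewrite !linearP linearPr scalerDr !scalerA mulrC.
move: a; apply: sum_is_linear => p a n n'; rewrite linearP; apply: tlift_linear.
split=> [n0|c]; apply: sum_is_linear => q {}a u u' /=.
  by rewrite linearPr scalerDl scalerA.
by rewrite !linearP linearPl scalerDr !scalerA mulrC.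
Qed.

HB.instance Definition _ := GRing.isLinear.Build k _ _ _ braid
  (tlift_linear braid_bilinear).

Lemma braidE m n : braid (m ⊗ n) = braid_pure m n.
Proof. exact: tlift_pure braid_bilinear _ _. Qed.

End Braiding.
End Long.

Arguments hassoc {k H B} U V W.
Arguments hassocV {k H B} U V W.
Arguments braid {k H B} M N.

(* Main.v *)
(** Write R and r, s for copies of the R-matrix. On a pure tensor the inner twists
    introduced by the associators cancel, and both composites apply one form to
    the iterated coactions and one product of three R-matrices to the modules.
    These parts are independent, so the theorem reduces to two identities.
    In H ⊗ H ⊗ H,
      sum r2R2 ⊗ s2R1 ⊗ s1r1 = sum s2r2 ⊗ s1R2 ⊗ r1R1,
    which is Delta^cop(R1) s ⊗ R2 = s Delta(R1) ⊗ R2 expanded by the formula for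
    Delta(R1) ⊗ R2; and, dually, in B,
      sum <v1|w1><u1|w2><u2|v2> = sum <u1|v1><u2|w1><v2|w2>,
    which is <u1v1|-><u2|v2> = <u1|v1><v2u2|-> expanded by multiplicativity of the
    form in its first argument. *)
From HB Require Import structures.
Require Import Defs.
From mathcomp Require Import all_boot all_algebra ring.

Set Implicit Arguments.
Unset Strict Implicit.
Unset Printing Implicit Defensive.

Import GRing.Theory.
Local Open Scope ring_scope.

(** * Multilinear maps and sums over representatives of tensors *)

Section Multilinear.
Variable k : fieldType.

Definition trilinear (U V W X : lmodType k) (f : U -> V -> W -> X) : Prop :=
  [/\ forall v w, linear (fun u => f u v w),
      forall u w, linear (fun v => f u v w)
    & forall u v, linear (f u v)].

Lemma scale_sum_linear (U X : lmodType k) (f : U -> X) (I : Type) (r : seq I)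
    (a : I -> k) (x : I -> U) :
  linear f -> f (\sum_(i <- r) a i *: x i) = \sum_(i <- r) a i *: f (x i).
Proof.
move=> fL; pose F : {linear U -> X} :=
  HB.pack f (GRing.isLinear.Build k U X _ f fL).
by rewrite -[f]/(F : U -> X) linear_sum; apply: eq_bigr => i _; rewrite linearZ.
Qed.

Lemma sum_linear (U X : lmodType k) (f : U -> X) (I : Type) (r : seq I)
    (x : I -> U) :
  linear f -> f (\sum_(i <- r) x i) = \sum_(i <- r) f (x i).
Proof.
move=> fL; pose F : {linear U -> X} :=
  HB.pack f (GRing.isLinear.Build k U X _ f fL).
exact: (linear_sum F).
Qed.

(** Bundling the induced map as a linear one makes [linear_sum] available, so that equalities of
    tensors can be transported to Sweedler sums. *)
Lemma bilinear_lift (U V X : lmodType k) (f : U -> V -> X) :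
  bilinear_for *:%R *:%R f ->
  exists2 F : {linear U ⊗[k] V -> X},
    tlift f =1 F & forall u v, F (u ⊗ v) = f u v.
Proof.
move=> fB; pose F : {linear U ⊗[k] V -> X} :=
  HB.pack (tlift f) (GRing.isLinear.Build k _ X _ _ (tlift_linear fB)).
by exists F => // u v; exact: tlift_pure fB u v.
Qed.

(** The universal property is needed for both bracketings: this one matches the coassociativity of
    coactions, [trilinear_liftl] the formula for the coproduct on the first leg of R. *)
Lemma trilinear_liftr (U V W X : lmodType k) (f : U -> V -> W -> X) :
  trilinear f ->
  exists F : {linear U ⊗[k] (V ⊗[k] W) -> X},
    forall u v w, F (u ⊗ (v ⊗ w)) = f u v w.
Proof.
case=> f1 f2 f3.
have fB u : bilinear_for *:%R *:%R (f u) by split=> *; [apply: f2 | apply: f3].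
have [] := @bilinear_lift U (V ⊗[k] W) X (fun u => tlift (f u)).
  split=> [t|u]; last exact: tlift_linear (fB u).
  by apply: sum_is_linear => p; apply: f1.
move=> F _ FE; exists F => u v w.
by rewrite FE (tlift_pure (fB u)).
Qed.

Lemma trilinear_liftl (U V W X : lmodType k) (f : U -> V -> W -> X) :
  trilinear f ->
  exists F : {linear U ⊗[k] V ⊗[k] W -> X},
    forall u v w, F (u ⊗ v ⊗ w) = f u v w.
Proof.
case=> f1 f2 f3.
have fB w : bilinear_for *:%R *:%R (fun u v => f u v w).
  by split=> *; [apply: f1 | apply: f2].
have [] := @bilinear_lift (U ⊗[k] V) W X (fun t w => tlift (fun u v => f u v w) t).
  split=> [w|t]; first exact: tlift_linear (fB w).
  by apply: sum_is_linear => p; apply: f3.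
move=> F _ FE; exists F => u v w.
by rewrite FE (tlift_pure (fB w)).
Qed.

Lemma scale_linear (U X : lmodType k) (c : k) (f : U -> X) :
  linear f -> linear (fun u => c *: f u).
Proof. by move=> fL a u v; rewrite fL scalerDr !scalerA mulrC. Qed.

(** Pulls a sum over R out of the coaction sums: the form coefficients do not involve R, so a copy
    of R can be fixed before the next braiding is expanded. *)
Lemma sum_scale_exchange (X : lmodType k) (I J L : Type) (r : seq I) (s : seq J)
    (t : J -> seq L) (a : J -> L -> k) (x : I -> J -> L -> X) :
  \sum_(i <- r) \sum_(j <- s) \sum_(l <- t j) a j l *: x i j l =
  \sum_(j <- s) \sum_(l <- t j) a j l *: \sum_(i <- r) x i j l.
Proof.
rewrite exchange_big; apply: eq_bigr => j _.
rewrite exchange_big; apply: eq_bigr => l _.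
by rewrite scaler_sumr.
Qed.

End Multilinear.

(** * The Yang-Baxter identity for the R-matrix *)

Section RMatrix.
Variables (k : fieldType) (H : quasitriangular k).

Lemma alpha_hmul (x y : H) : alpha (hmul x y) = hmul (alpha x) (alpha y).
Proof. exact: (alpha_mul (bialg_alg (hopf_bialg H))). Qed.

Lemma alphaV_hmul (x y : H) :
  lin_inv alpha (hmul (alpha x) (alpha y)) = hmul x y.
Proof. by rewrite -alpha_hmul lin_funK. Qed.

(** An axiom on R is an equality of tensors; applying the linear map induced by [f] turns it into an
    equality of sums. [sum_Rmx_Delta] and [sum_Rmx_comm] arise in the same way. *)
Lemma sum_Rmx_alpha (X : lmodType k) (f : H -> H -> X) :
  bilinear_for *:%R *:%R f ->
  \sum_(r <- repr (Rmx H)) f (alpha r.1) (alpha r.2) =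
  \sum_(r <- repr (Rmx H)) f r.1 r.2.
Proof.
case/bilinear_lift=> F FE Fp; rewrite -[RHS]/(tlift f (Rmx H)) FE -[in RHS]Rmx_alpha.
by rewrite linear_sum; apply: eq_bigr => r _; rewrite Fp.
Qed.

Lemma sum_Rmx_Delta (X : lmodType k) (f : H -> H -> H -> X) : trilinear f ->
  \sum_(r <- repr (Rmx H)) \sum_(d <- repr (Delta r.1)) f d.1 d.2 (alpha r.2) =
  \sum_(r <- repr (Rmx H)) \sum_(r' <- repr (Rmx H))
    f (alpha r.1) (alpha r'.1) (hmul r.2 r'.2).
Proof.
case/trilinear_liftl=> F FE; have := congr1 F (Delta_Rmx H).
rewrite /tlift !linear_sum /= => E.
transitivity (\sum_(r <- repr (Rmx H)) F (Delta r.1 ⊗ alpha r.2)).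
  apply: eq_bigr => r _; rewrite [in RHS](tensor_reprE (Delta r.1)).
  by rewrite linear_sumlz linear_sum; apply: eq_bigr => d _; rewrite FE.
rewrite E; apply: eq_bigr => r _; rewrite linear_sum.
by apply: eq_bigr => r' _; rewrite FE.
Qed.

Lemma sum_Rmx_comm (X : lmodType k) (f : H -> H -> X) (h : H) :
  bilinear_for *:%R *:%R f ->
  \sum_(d <- repr (Delta h)) \sum_(r <- repr (Rmx H))
    f (hmul r.1 d.1) (hmul r.2 d.2) =
  \sum_(d <- repr (Delta h)) \sum_(r <- repr (Rmx H))
    f (hmul d.2 r.1) (hmul d.1 r.2).
Proof.
case/bilinear_lift=> F _ FE; have := congr1 F (Rmx_comm h).
rewrite /tlift exchange_big !linear_sum /= => E.
transitivity (\sum_(r <- repr (Rmx H)) F (\sum_(d <- repr (Delta h))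
   hmul r.1 d.1 ⊗ hmul r.2 d.2)); last rewrite -E.
  rewrite exchange_big; apply: eq_bigr => d _; rewrite linear_sum.
  by apply: eq_bigr => r _; rewrite FE.
rewrite exchange_big; apply: eq_bigr => d _; rewrite linear_sum.
by apply: eq_bigr => r _; rewrite FE.
Qed.

Lemma Rmx_YBE (X : lmodType k) (f : H -> H -> H -> X) : trilinear f ->
  \sum_(r <- repr (Rmx H)) \sum_(r' <- repr (Rmx H)) \sum_(s <- repr (Rmx H))
    f (hmul r'.2 r.2) (hmul s.2 r.1) (hmul s.1 r'.1) =
  \sum_(r <- repr (Rmx H)) \sum_(r' <- repr (Rmx H)) \sum_(s <- repr (Rmx H))
    f (hmul s.2 r'.2) (hmul s.1 r.2) (hmul r'.1 r.1).
Proof.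
case=> f1 f2 f3.
(* [sum_Rmx_comm] acts on the first two tensor legs, so the legs are reversed;
   the inverse twists absorb those created by [sum_Rmx_Delta]. *)
pose g x y z := f z (lin_inv alpha y) (lin_inv alpha x).
pose R := repr (Rmx H).
have gB z : bilinear_for *:%R *:%R (fun x y => g x y z).
  by split=> [y|x] a u v; rewrite /g linearP ?f3 ?f2.
have gT : trilinear (fun x y z => \sum_(s <- R) g (hmul s.1 x) (hmul s.2 y) z).
  split=> [y z|x z|x y]; apply: sum_is_linear => s a u v; rewrite /g.
  - by rewrite linearPr linearP f3.
  - by rewrite linearPr linearP f2.
  - by rewrite f1.
have gT' : trilinear (fun x y z => \sum_(s <- R) g (hmul y s.1) (hmul x s.2) z).
  split=> [y z|x z|x y]; apply: sum_is_linear => s a u v; rewrite /g.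
  - by rewrite linearPl linearP f2.
  - by rewrite linearPl linearP f3.
  - by rewrite f1.
transitivity (\sum_(r <- R) \sum_(r' <- R) \sum_(s <- R)
    g (hmul s.1 (alpha r.1)) (hmul s.2 (alpha r'.1)) (hmul r.2 r'.2)).
  rewrite exchange_big; apply: eq_bigr => r _; apply: eq_bigr => r' _.
  (* Since R is invariant, the copy [s] may be twisted as well; each product is then a value of
     [alpha], which the inverse twist in [g] removes. *)
  rewrite -(sum_Rmx_alpha
    (f := fun x y => g (hmul x (alpha r.1)) (hmul y (alpha r'.1)) _)).
    by apply: eq_bigr => s _; rewrite /g !alphaV_hmul.
  by split=> [y|x] a u v; rewrite linearPl; [apply: (gB _).1 | apply: (gB _).2].
(* Two copies of R collapse into a coproduct, the third passes to its other side, and the coproduct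
   is expanded again. *)
rewrite -(sum_Rmx_Delta gT).
under eq_bigr => r _ do rewrite (sum_Rmx_comm r.1 (gB (alpha r.2))).
rewrite (sum_Rmx_Delta gT').
transitivity (\sum_(r <- R) \sum_(r' <- R) \sum_(s <- R)
    f (hmul r.2 r'.2) (hmul r.1 s.2) (hmul r'.1 s.1)).
  apply: eq_bigr => r _; apply: eq_bigr => r' _.
  rewrite -(sum_Rmx_alpha
    (f := fun x y => g (hmul (alpha r'.1) x) (hmul (alpha r.1) y) _)).
    by apply: eq_bigr => s _; rewrite /g !alphaV_hmul.
  by split=> [y|x] a u v; rewrite linearPr; [apply: (gB _).1 | apply: (gB _).2].
(* The two sides now differ only in the names of the three copies of R. *)
rewrite exchange_big [RHS]exchange_big; apply: eq_bigr => r _.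
by rewrite exchange_big.
Qed.

End RMatrix.

(** * The dual identity for the form *)

Section Form.
Variables (k : fieldType) (B : coquasitriangular k).

Lemma cform_alphaV (x y : B) :
  cform (lin_inv alpha x) (lin_inv alpha y) = cform x y.
Proof. by rewrite -cform_alpha !lin_invK. Qed.

(* The two twists on [l] allow arbitrary [x] and [y] on the left-hand side. *)
Lemma cform_hmull (x y l : B) :
  \sum_(d <- repr (Delta l)) cform y d.1 * cform x d.2 =
  cform (hmul x y) (alpha (alpha l)).
Proof.
have <- : alpha (hmul (lin_inv alpha x) (lin_inv alpha y)) = hmul x y :> B.
  by rewrite (alpha_mul (bialg_alg (hopf_bialg B))) !lin_invK.
rewrite cform_alpha cform_mull; apply: eq_bigr => d _.
by rewrite !lin_invK mulrC.
Qed.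

(** Obtained by pairing both sides of [cform_comm] with one element and expanding the products
    [e.2 d.2] and [d.1 e.1] over [Delta w]. *)
Lemma cform_YBE (u v w : B) :
  \sum_(d <- repr (Delta u)) \sum_(e <- repr (Delta v)) \sum_(g <- repr (Delta w))
    cform e.1 g.1 * cform d.1 g.2 * cform d.2 e.2 =
  \sum_(d <- repr (Delta u)) \sum_(e <- repr (Delta v)) \sum_(g <- repr (Delta w))
    cform d.1 e.1 * cform d.2 g.1 * cform e.2 g.2.
Proof.
(* The double twist is the one demanded by [cform_hmull]. *)
pose z : B := alpha (alpha w).
have := congr1 (fun t => cform t z) (cform_comm u v).
rewrite /tlift !linear_sumlz /=.
under eq_bigr => d _ do rewrite linear_sumlz.
under [RHS]eq_bigr => d _ do rewrite linear_sumlz.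
move=> E; symmetry.
transitivity (\sum_(d <- repr (Delta u)) \sum_(e <- repr (Delta v))
    cform (cform d.1 e.1 *: hmul e.2 d.2) z).
  apply: eq_bigr => d _; apply: eq_bigr => e _.
  rewrite linearZl_LR /= -cform_hmull mulr_sumr.
  by apply: eq_bigr => g _; rewrite mulrA.
rewrite E; apply: eq_bigr => d _; apply: eq_bigr => e _.
rewrite linearZl_LR /= -cform_hmull mulr_sumr.
by apply: eq_bigr => g _; rewrite mulrC.
Qed.

End Form.

(** * Coactions on iterated and on braided elements *)

Section Coaction.
Variables (k : fieldType) (H B : homHopfAlgebra k).

(** Coassociativity, with the twist of the first leg moved to the other side as an inverse; it
    trades an iterated coaction for a coproduct in B. *)
Lemma sum_coact_coact (M : longDimodule H B) (X : lmodType k)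
    (f : B -> B -> M -> X) (m : M) : trilinear f ->
  \sum_(p <- repr (coact m)) \sum_(p' <- repr (coact p.2)) f p.1 p'.1 p'.2 =
  \sum_(p <- repr (coact m)) \sum_(d <- repr (Delta p.1))
    f (lin_inv alpha d.1) d.2 (mu M p.2).
Proof.
case=> f1 f2 f3.
have [|F FE] := @trilinear_liftr k _ _ _ X
  (fun x y z => f (lin_inv alpha x) y z).
  by split=> [y z|x z|x y] a t t'; rewrite ?linearP ?f1 ?f2 ?f3.
have := congr1 F (coact_homA (long_comodule M) m).
rewrite /tlift !linear_sum /= => E.
transitivity (\sum_(p <- repr (coact m)) F (\sum_(p' <- repr (coact p.2))
    (alpha p.1 ⊗ (p'.1 ⊗ p'.2)))); last rewrite E.
  apply: eq_bigr => p _; rewrite linear_sum; apply: eq_bigr => p' _.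
  by rewrite FE lin_funK.
apply: eq_bigr => p _; rewrite linear_sum; apply: eq_bigr => p' _.
by rewrite FE.
Qed.

Lemma coact_alphaV (M : longDimodule H B) (m : M) :
  coact (lin_inv (mu M) m) = tmap (lin_inv alpha) (lin_inv (mu M)) (coact m).
Proof.
rewrite -{2}[m](lin_invK (mu M)) (mu_coact (long_comodule M)) /tlift linear_sum.
rewrite {1}[LHS]tensor_reprE; apply: eq_bigr => p _.
by rewrite /= tmap_pure !lin_funK.
Qed.

(** The argument of [coact] has the shape that a braiding outputs. The dimodule axiom contributes
    one twist on the B-leg and the two inverse structure maps two inverse twists, which leaves one
    inverse. *)
Lemma coact_act (M : longDimodule H B) (h : H) (m : M) :
  coact (act h (lin_inv (mu M) (lin_inv (mu M) m))) =
  \sum_(p <- repr (coact m)) lin_inv alpha p.1 ⊗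
     act (alpha h) (lin_inv (mu M) (lin_inv (mu M) p.2)).
Proof.
rewrite long_compat.
have [|F -> FE] := @bilinear_lift k B M _ (fun b m0 => alpha b ⊗ act (alpha h) m0).
  by split=> [x|x] a y y'; rewrite ?linearP ?linearPl ?linearPr.
rewrite !coact_alphaV.
pose T : {linear B ⊗[k] M -> B ⊗[k] M} := tmap (lin_inv alpha) (lin_inv (mu M)).
rewrite -[LHS]/((F \o T \o T) (coact m)) {1}(tensor_reprE (coact m)).
rewrite linear_sum.
by apply: eq_bigr => p _; rewrite /= !tmap_pure FE lin_invK.
Qed.

End Coaction.

(** * Expansion of a braiding inside a linear map *)

Section Braid.
Variables (k : fieldType) (H : quasitriangular k) (B : coquasitriangular k).

(* The decompositions of the coactions are arbitrary, so that those of [coact_act]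
   can be used for elements produced by an earlier braiding. *)
Lemma linear_braid (M N : longDimodule H B) (X : lmodType k)
    (f : N ⊗[k] M -> X) (I J : Type) (r : seq I) (s : seq J)
    (b : I -> B) (m' : I -> M) (c : J -> B) (n' : J -> N) (m : M) (n : N) :
  linear f ->
  coact m = \sum_(i <- r) b i ⊗ m' i -> coact n = \sum_(j <- s) c j ⊗ n' j ->
  f (braid M N (m ⊗ n)) = \sum_(i <- r) \sum_(j <- s) cform (b i) (c j) *:
    \sum_(x <- repr (Rmx H))
      f (act x.2 (lin_inv (mu N) (lin_inv (mu N) (n' j))) ⊗
         act x.1 (lin_inv (mu M) (lin_inv (mu M) (m' i)))).
Proof.
move=> fL mE nE.
(* [h] is bilinear in its first two and in its last two arguments, so its sum over a coaction
   depends only on the tensor; the two decompositions are replaced one after the other. *)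
pose h (b : B) (m : M) (c : B) (n : N) : X := cform b c *:
    \sum_(x <- repr (Rmx H))
      f (act x.2 (lin_inv (mu N) (lin_inv (mu N) n)) ⊗
         act x.1 (lin_inv (mu M) (lin_inv (mu M) m))).
have hr b0 m0 : bilinear_for *:%R *:%R (h b0 m0).
  split=> [y|y] a z z'; rewrite /h.
    by rewrite linearPr /= scalerDl scalerA.
  move: a z z'; apply/scale_linear/sum_is_linear => x a z z'.
  by rewrite !linearP ?linearPr ?linearPl fL.
have hl c0 n0 : bilinear_for *:%R *:%R (fun b m => h b m c0 n0).
  split=> [y|y] a z z'; rewrite /h.
    by rewrite linearPl /= scalerDl scalerA.
  move: a z z'; apply/scale_linear/sum_is_linear => x a z z'.
  by rewrite !linearP ?linearPr fL.
transitivity (\sum_(p <- repr (coact m)) \sum_(q <- repr (coact n))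
    h p.1 p.2 q.1 q.2).
  rewrite braidE /braid_pure /tlift.
  rewrite (sum_linear _ _ fL); apply: eq_bigr => p _.
  rewrite (sum_linear _ _ fL); apply: eq_bigr => q _.
  by rewrite (scale_sum_linear _ _ _ fL) /h scaler_sumr.
transitivity (\sum_(p <- repr (coact m)) \sum_(j <- s)
    h p.1 p.2 (c j) (n' j)).
  apply: eq_bigr => p _; have [F FE Fp] := bilinear_lift (hr p.1 p.2).
  rewrite -[LHS]/(tlift (h p.1 p.2) (coact n)) FE nE linear_sum.
  by apply: eq_bigr => j _; rewrite Fp.
rewrite exchange_big [RHS]exchange_big; apply: eq_bigr => j _.
have [F FE Fp] := bilinear_lift (hl (c j) (n' j)).
rewrite -[LHS]/(tlift (fun b m => h b m (c j) (n' j)) (coact m)) FE mE.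
rewrite linear_sum.
by apply: eq_bigr => i _; rewrite Fp.
Qed.

End Braid.

(** * The form identity transported to iterated coactions *)

Section CoactionYBE.
Variables (k : fieldType) (H : homHopfAlgebra k) (B : coquasitriangular k).
Variables (U V W : longDimodule H B) (X : lmodType k).
Variable F : U -> V -> W -> X.
Hypothesis F_trilinear : trilinear F.

(** Coassociativity applied to [u], [v] and [w] in turn. All dependence on the inner legs in B is
    gathered into one scalar in front of the module part, where [cform_YBE] can act. *)
Lemma sum_coact_coact3 (c : B -> B -> B -> B -> B -> B -> k) u v w :
  (forall t' p p' q q', scalar (fun t => c t t' p p' q q')) ->
  (forall t p p' q q', scalar (fun t' => c t t' p p' q q')) ->
  (forall t t' p' q q', scalar (fun p => c t t' p p' q q')) ->
  (forall t t' p q q', scalar (fun p' => c t t' p p' q q')) ->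
  (forall t t' p p' q', scalar (fun q => c t t' p p' q q')) ->
  (forall t t' p p' q, scalar (fun q' => c t t' p p' q q')) ->
  \sum_(t <- repr (coact u)) \sum_(t' <- repr (coact t.2))
    \sum_(p <- repr (coact v)) \sum_(p' <- repr (coact p.2))
    \sum_(q <- repr (coact w)) \sum_(q' <- repr (coact q.2))
      c t.1 t'.1 p.1 p'.1 q.1 q'.1 *: F t'.2 p'.2 q'.2 =
  \sum_(t <- repr (coact u)) \sum_(p <- repr (coact v)) \sum_(q <- repr (coact w))
    (\sum_(d <- repr (Delta t.1)) \sum_(e <- repr (Delta p.1))
     \sum_(g <- repr (Delta q.1))
      c (lin_inv alpha d.1) d.2 (lin_inv alpha e.1) e.2 (lin_inv alpha g.1) g.2)
    *: F (mu U t.2) (mu V p.2) (mu W q.2).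
Proof.
have [F1 F2 F3] := F_trilinear.
have scL (f : B -> k) (x : X) : scalar f -> linear (fun b => f b *: x).
  by move=> fL a b b'; rewrite fL scalerDl scalerA.
move=> c1 c2 c3 c4 c5 c6.
rewrite (sum_coact_coact (f := fun x y z => \sum_(p <- repr (coact v))
  \sum_(p' <- repr (coact p.2)) \sum_(q <- repr (coact w))
  \sum_(q' <- repr (coact q.2)) c x y p.1 p'.1 q.1 q'.1 *: F z p'.2 q'.2)); last first.
  split=> *; do 4![apply: sum_is_linear => ?].
  - exact: scL.
  - exact: scL.
  - exact: scale_linear.
apply: eq_bigr => t _.
transitivity (\sum_(d <- repr (Delta t.1)) \sum_(p <- repr (coact v))
    \sum_(e <- repr (Delta p.1)) \sum_(q <- repr (coact w))
    \sum_(g <- repr (Delta q.1))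
    c (lin_inv alpha d.1) d.2 (lin_inv alpha e.1) e.2 (lin_inv alpha g.1) g.2
    *: F (mu U t.2) (mu V p.2) (mu W q.2)).
  apply: eq_bigr => d _.
  rewrite (sum_coact_coact (f := fun x y z => \sum_(q <- repr (coact w))
    \sum_(q' <- repr (coact q.2))
    c (lin_inv alpha d.1) d.2 x y q.1 q'.1 *: F (mu U t.2) z q'.2)); last first.
    split=> *; do 2![apply: sum_is_linear => ?].
    - exact: scL.
    - exact: scL.
    - exact: scale_linear.
  apply: eq_bigr => p _; apply: eq_bigr => e _.
  rewrite (sum_coact_coact (f := fun x y z =>
    c (lin_inv alpha d.1) d.2 (lin_inv alpha e.1) e.2 x y
      *: F (mu U t.2) (mu V p.2) z)) //.
  by split=> *; [exact: scL | exact: scL | exact: scale_linear].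
(* Only the order of summation remains: the three coproduct sums move inside the scalar. *)
rewrite exchange_big; apply: eq_bigr => p _.
under [RHS]eq_bigr => q _ do rewrite scaler_suml.
rewrite [RHS]exchange_big; apply: eq_bigr => d _.
under [RHS]eq_bigr => q _ do rewrite scaler_suml.
rewrite [RHS]exchange_big; apply: eq_bigr => e _.
by apply: eq_bigr => q _; rewrite scaler_suml.
Qed.

(** The nesting is the one produced by expanding three braidings in a row, with [F] standing for the
    part that involves R; the inverse twists are those of [coact_act]. *)
Lemma coact_YBE u v w :
  \sum_(p <- repr (coact v)) \sum_(q <- repr (coact w)) cform p.1 q.1 *:
    \sum_(t <- repr (coact u)) \sum_(q' <- repr (coact q.2))
      cform t.1 (lin_inv alpha q'.1) *:
    \sum_(t' <- repr (coact t.2)) \sum_(p' <- repr (coact p.2))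
      cform (lin_inv alpha t'.1) (lin_inv alpha p'.1) *: F t'.2 p'.2 q'.2 =
  \sum_(t <- repr (coact u)) \sum_(p <- repr (coact v)) cform t.1 p.1 *:
    \sum_(t' <- repr (coact t.2)) \sum_(q <- repr (coact w))
      cform (lin_inv alpha t'.1) q.1 *:
    \sum_(p' <- repr (coact p.2)) \sum_(q' <- repr (coact q.2))
      cform (lin_inv alpha p'.1) (lin_inv alpha q'.1) *: F t'.2 p'.2 q'.2.
Proof.
(* The three form factors of each side, with arguments grouped by module as [sum_coact_coact3]
   requires. *)
pose cl (t t' p p' q q' : B) : k := cform p q * cform t (lin_inv alpha q') *
  cform (lin_inv alpha t') (lin_inv alpha p').
pose cr (t t' p p' q q' : B) : k := cform t p * cform (lin_inv alpha t') q *
  cform (lin_inv alpha p') (lin_inv alpha q').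
transitivity (\sum_(t <- repr (coact u)) \sum_(t' <- repr (coact t.2))
    \sum_(p <- repr (coact v)) \sum_(p' <- repr (coact p.2))
    \sum_(q <- repr (coact w)) \sum_(q' <- repr (coact q.2))
      cl t.1 t'.1 p.1 p'.1 q.1 q'.1 *: F t'.2 p'.2 q'.2).
  transitivity (\sum_(p <- repr (coact v)) \sum_(q <- repr (coact w))
    \sum_(t <- repr (coact u)) \sum_(q' <- repr (coact q.2))
    \sum_(t' <- repr (coact t.2)) \sum_(p' <- repr (coact p.2))
      cl t.1 t'.1 p.1 p'.1 q.1 q'.1 *: F t'.2 p'.2 q'.2).
    do 2![apply: eq_bigr => ? _; rewrite ?scaler_sumr].
    do 2![apply: eq_bigr => ? _; rewrite ?scaler_sumr].
    by do 2![apply: eq_bigr => ? _; rewrite ?scaler_sumr]; rewrite !scalerA.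
  under eq_bigr => p _ do rewrite exchange_big.
  rewrite exchange_big; apply: eq_bigr => t _.
  rewrite [RHS]exchange_big; apply: eq_bigr => p _.
  transitivity (\sum_(q <- repr (coact w)) \sum_(t' <- repr (coact t.2))
    \sum_(p' <- repr (coact p.2)) \sum_(q' <- repr (coact q.2))
      cl t.1 t'.1 p.1 p'.1 q.1 q'.1 *: F t'.2 p'.2 q'.2).
    apply: eq_bigr => q _; rewrite exchange_big; apply: eq_bigr => t' _.
    exact: exchange_big.
  by rewrite exchange_big; apply: eq_bigr => t' _; apply: exchange_big.
transitivity (\sum_(t <- repr (coact u)) \sum_(t' <- repr (coact t.2))
    \sum_(p <- repr (coact v)) \sum_(p' <- repr (coact p.2))
    \sum_(q <- repr (coact w)) \sum_(q' <- repr (coact q.2))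
      cr t.1 t'.1 p.1 p'.1 q.1 q'.1 *: F t'.2 p'.2 q'.2); last first.
  apply: eq_bigr => t _.
  rewrite exchange_big; apply: eq_bigr => p _; rewrite scaler_sumr.
  apply: eq_bigr => t' _; rewrite exchange_big scaler_sumr.
  apply: eq_bigr => q _; rewrite scalerA scaler_sumr.
  apply: eq_bigr => p' _; rewrite scaler_sumr.
  by apply: eq_bigr => q' _; rewrite scalerA.
rewrite !sum_coact_coact3; first last.
(* Linearity of [cl] and of [cr] in each of the six arguments. *)
1-12: by move=> * a x y; rewrite /cl /cr ?linearP ?linearPl ?linearPr /=; ring.
do 3![apply: eq_bigr => ? _]; congr (_ *: _).
(* Coassociativity has added inverse twists to the first legs, so both arguments of every form now
   carry one and they cancel. *)
under eq_bigr => d _ do under eq_bigr => e _ do under eq_bigr => g _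
  do rewrite /cl !cform_alphaV.
under [RHS]eq_bigr => d _ do under eq_bigr => e _ do under eq_bigr => g _
  do rewrite /cr !cform_alphaV.
exact: cform_YBE.
Qed.

End CoactionYBE.

(** * Merging of actions and comparison of the two composites *)

(** Two successive R-matrix actions become one product: the inverse structure maps pass through the
    inner action, and Hom-associativity applies once [h] is written as a twist. *)
Lemma act_act (k : fieldType) (H B : homHopfAlgebra k) (M : longDimodule H B)
    (g h : H) (m : M) :
  act h (lin_inv (mu M) (lin_inv (mu M) (act (alpha g) m))) =
  act (lin_inv alpha (hmul h g)) (lin_inv (mu M) m).
Proof.
have muV x y : lin_inv (mu M) (act (alpha x) y) = act x (lin_inv (mu M) y).
  apply: (can_inj (lin_funK (mu M))).
  by rewrite (mu_act (long_module M)) !lin_invK.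
rewrite muV -{1}[g](lin_invK alpha) muV -{1}[h](lin_invK alpha).
rewrite (act_homA (long_module M)) lin_invK; congr (act _ _).
apply: (can_inj (lin_funK alpha)).
by rewrite (alpha_mul (bialg_alg (hopf_bialg H))) !lin_invK.
Qed.

Theorem corollary3p2 (k : fieldType) (H : quasitriangular k)
    (B : coquasitriangular k) (U V W : longDimodule H B) :
  (tmap idfun (braid U V) \o hassoc W U V \o tmap (braid U W) idfun \o
     hassocV U W V \o tmap idfun (braid V W) \o hassoc U V W)
  =1
  (hassoc W V U \o tmap (braid V W) idfun \o hassocV V W U \o
     tmap idfun (braid U W) \o hassoc V U W \o tmap (braid U V) idfun
   : U ⊗[k] V ⊗[k] W -> W ⊗[k] (V ⊗[k] U)).
Proof.
apply: tensor_extl => u v w /=.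
rewrite hassocE !tmap_pure /=.
pose n3 (M : longDimodule H B) (m : M) : M :=
  lin_inv (mu M) (lin_inv (mu M) (lin_inv (mu M) m)).
(* The common shape of both results. [n3] and the inverse twists come from [act_act]; the extra
   inverse on the W-leg comes from the last associator. *)
pose E (u : U) (v : V) (w : W) (x y z : H) : W ⊗[k] (V ⊗[k] U) :=
  lin_inv (mu W) (act (lin_inv alpha x) (n3 W w)) ⊗
  (act (lin_inv alpha y) (n3 V v) ⊗ act (lin_inv alpha z) (n3 U u)).
pose R := repr (Rmx H).
pose F u v w := \sum_(r <- R) \sum_(r' <- R) \sum_(s <- R)
  E u v w (hmul r'.2 r.2) (hmul s.2 r.1) (hmul s.1 r'.1).
have F_tri : trilinear F.
  by split=> *; do 3![apply: sum_is_linear => ?] => a x y;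
    rewrite /E /n3 !(linearP, linearPr, linearPl).
(* By the R-matrix identity the same [F] describes the module part of the second composite. *)
have FE u' v' w' : F u' v' w' = \sum_(r <- R) \sum_(r' <- R) \sum_(s <- R)
    E u' v' w' (hmul s.2 r'.2) (hmul s.1 r.2) (hmul r'.1 r.1).
  by apply: Rmx_YBE; split=> * a x y;
    rewrite /E !(linearP, linearPr, linearPl).
(* Expansion of the first composite, one braiding at a time. In each call of [linear_braid], [f] is
   the remaining composite; legs already braided use the decomposition from [coact_act]. *)
transitivity (\sum_(p <- repr (coact v)) \sum_(q <- repr (coact (mu W w)))
    cform p.1 q.1 *:
    \sum_(t <- repr (coact u)) \sum_(q' <- repr (coact q.2))
      cform t.1 (lin_inv alpha q'.1) *:
    \sum_(t' <- repr (coact t.2)) \sum_(p' <- repr (coact p.2))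
      cform (lin_inv alpha t'.1) (lin_inv alpha p'.1) *: F t'.2 p'.2 q'.2).
  rewrite (linear_braid
    (f := fun y => tmap idfun (braid U V) (hassoc W U V (tmap (braid U W) idfun
      (hassocV U W V (lin_inv (mu U) u ⊗ y))))) _
      (tensor_reprE _) (tensor_reprE _)); last first.
    by move=> a x y; rewrite linearPr !linearP.
  apply: eq_bigr => p _; apply: eq_bigr => q _; congr (_ *: _).
  transitivity (\sum_(t <- repr (coact u)) \sum_(q' <- repr (coact q.2))
     cform t.1 (lin_inv alpha q'.1) *: \sum_(r <- R)
     (\sum_(t' <- repr (coact t.2)) \sum_(p' <- repr (coact p.2))
      cform (lin_inv alpha t'.1) (lin_inv alpha p'.1) *:
      \sum_(r' <- R) \sum_(s <- R)
       E t'.2 p'.2 q'.2 (hmul r'.2 r.2) (hmul s.2 r.1) (hmul s.1 r'.1))); last first.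
    apply: eq_bigr => t _; apply: eq_bigr => q' _; congr (_ *: _).
    exact: sum_scale_exchange.
  rewrite -sum_scale_exchange; apply: eq_bigr => r _.
  rewrite hassocVE lin_invK tmap_pure /=.
  rewrite (linear_braid
    (f := fun y => tmap idfun (braid U V) (hassoc W U V (y ⊗ lin_inv (mu V) _)))
      _ (tensor_reprE _) (coact_act _ _)); last first.
    by move=> a x y; rewrite linearPl !linearP.
  apply: eq_bigr => t _; apply: eq_bigr => q' _; congr (_ *: _).
  rewrite -sum_scale_exchange; apply: eq_bigr => r' _.
  rewrite hassocE lin_invK tmap_pure /=.
  rewrite (linear_braid (f := fun y => _ ⊗ y) _ (coact_act _ _) (coact_act _ _));
    last by move=> a x y; rewrite linearPr.
  apply: eq_bigr => t' _; apply: eq_bigr => p' _; congr (_ *: _).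
  by apply: eq_bigr => s _; rewrite !act_act.
(* The form coefficients are now those of the second composite, which is expanded in the same
   manner. *)
rewrite (coact_YBE F_tri); symmetry.
rewrite (linear_braid
    (f := fun y => hassoc W V U (tmap (braid V W) idfun (hassocV V W U
      (tmap idfun (braid U W) (hassoc V U W (y ⊗ w)))))) _
      (tensor_reprE _) (tensor_reprE _)); last first.
  by move=> a x y; rewrite linearPl !linearP.
apply: eq_bigr => t _; apply: eq_bigr => p _; congr (_ *: _).
transitivity (\sum_(t' <- repr (coact t.2)) \sum_(q <- repr (coact (mu W w)))
     cform (lin_inv alpha t'.1) q.1 *: \sum_(r <- R)
     (\sum_(p' <- repr (coact p.2)) \sum_(q' <- repr (coact q.2))
      cform (lin_inv alpha p'.1) (lin_inv alpha q'.1) *: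
      \sum_(r' <- R) \sum_(s <- R)
       E t'.2 p'.2 q'.2 (hmul s.2 r'.2) (hmul s.1 r.2) (hmul r'.1 r.1))); last first.
  apply: eq_bigr => t' _; apply: eq_bigr => q _; congr (_ *: _).
  rewrite sum_scale_exchange; apply: eq_bigr => p' _; apply: eq_bigr => q' _.
  by rewrite FE.
rewrite -sum_scale_exchange; apply: eq_bigr => r _.
rewrite hassocE tmap_pure /=.
rewrite (linear_braid
    (f := fun y => hassoc W V U (tmap (braid V W) idfun (hassocV V W U
      (lin_inv (mu V) _ ⊗ y)))) _ (coact_act _ _) (tensor_reprE _)); last first.
  by move=> a x y; rewrite linearPr !linearP.
apply: eq_bigr => t' _; apply: eq_bigr => q _; congr (_ *: _).
rewrite -sum_scale_exchange; apply: eq_bigr => r' _.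
rewrite hassocVE lin_invK tmap_pure /=.
rewrite (linear_braid (f := fun y => hassoc W V U (y ⊗ lin_inv (mu U) _))
  _ (coact_act _ _) (coact_act _ _)); last by move=> a x y; rewrite linearPl !linearP.
apply: eq_bigr => p' _; apply: eq_bigr => q' _; congr (_ *: _).
by apply: eq_bigr => s _; rewrite hassocE lin_invK !act_act.
Qed.
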